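(* Let $\eta$ be any positive equivalence relation. If $\mathbb N$ is the only $\eta$-infinite r.e. set, then there is an $\eta$-family that is explanatorily learnable but not weakly confidently learnable.
   Context: A positive equivalence relation is an equivalence relation $\eta$ on $\mathbb{N}$ that is recursively enumerable (as a set of pairs) and has infinitely many equivalence classes. A set is $\eta$-closed if it is a union of $\eta$-classes and $\eta$-infinite if it is a union of infinitely many $\eta$-classes. An $\eta$-family is an infinite family of $\eta$-closed sets possessing a uniformly r.e. one-one numbering $B_0,B_1,\dots$ (i.e. $\{\langle k,x\rangle:x\in B_k\}$ is r.e. and $B_i\neq B_j$ for $i\ne j$). $W_0,W_1,\dots$ is a fixed acceptable numbering of the r.e. sets. A text for $L$ is a total $T:\mathbb N\to\mathbb N\cup\{\#\}$ whose range minus $\{\#\}$ is $L$; $T[n]$ is its initial segment of length $n$ and $\mathrm{cnt}(T)$ its range minus $\{\#\}$. A learner is a recursive function $M$ from finite sequences over $\mathbb N\cup\{\#\}$ to $\mathbb N\cup\{?\}$; an output $e$ is interpreted as the hypothesis ''the $\eta$-closure of $W_e$''. $M$ explanatorily learns $\mathcal C$ if on every text $T$ for every $L\in\mathcal C$ it outputs from some point on a single index whose hypothesis equals $L$; $M$ weakly confidently learns $\mathcal C$ if it explanatorily learns $\mathcal C$ and $M(T[n])$ converges on every text $T$ with $\mathrm{cnt}(T)\subseteq L$ for some $L\in\mathcal C$. *)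

(* Defs.v *)
From Stdlib Require Import RelationClasses.
From Stdlib Require Cantor.
From mathcomp Require Import all_boot.
From mathcomp Require Import boolp classical_sets functions cardinality.

Set Implicit Arguments.
Unset Strict Implicit.
Unset Printing Implicit Defensive.

Local Open Scope classical_set_scope.

(** The total recursive functions, of every arity: initial functions,
    substitution, primitive recursion, and minimization of regular functions
    (those with a zero above every [v]; totality of [f] in [rec_min] enforces
    regularity).  Each closure rule characterizes [f] by its defining equations,
    so the class is closed under extensional equality. *)
Inductive recursive : forall n : nat, (n.-tuple nat -> nat) -> Prop :=
| rec_zero n : recursive (fun _ : n.-tuple nat => 0)
| rec_succ : recursive (fun v : 1.-tuple nat => (thead v).+1)
| rec_proj n (i : 'I_n) : recursive (fun v : n.-tuple nat => tnth v i)
| rec_comp m n (g : m.-tuple nat -> nat) (h : 'I_m -> n.-tuple nat -> nat)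
    (f : n.-tuple nat -> nat) :
    recursive g -> (forall i, recursive (h i)) ->
    (forall v, f v = g [tuple h i v | i < m]) ->
    recursive f
| rec_prim n (g : n.-tuple nat -> nat) (h : n.+2.-tuple nat -> nat)
    (f : n.+1.-tuple nat -> nat) :
    recursive g -> recursive h ->
    (forall v, f (cons_tuple 0 v) = g v) ->
    (forall y v, f (cons_tuple y.+1 v)
                 = h (cons_tuple y (cons_tuple (f (cons_tuple y v)) v))) ->
    recursive f
| rec_min n (g : n.+1.-tuple nat -> nat) (f : n.-tuple nat -> nat) :
    recursive g ->
    (forall v, g (cons_tuple (f v) v) = 0) ->
    (forall v y, y < f v -> g (cons_tuple y v) <> 0) ->
    recursive f.

Definition recursive1 (f : nat -> nat) : Prop :=
  recursive (fun v : 1.-tuple nat => f (thead v)).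

Definition re (A : set nat) : Prop :=
  A = set0 \/ exists2 f : nat -> nat, recursive1 f & A = range f.

Definition re2 (R : nat -> nat -> Prop) : Prop :=
  re [set z | exists x y, z = Cantor.to_nat (x, y) /\ R x y].

Definition uniformly_re (B : nat -> set nat) : Prop := re2 B.

(** Acceptable numberings of the r.e. sets: uniformly r.e., and every uniformly
    r.e. sequence translates effectively into [W] (so that, in particular, every
    r.e. set is some [W e]). *)
Definition acceptable (W : nat -> set nat) : Prop :=
  uniformly_re W /\
  forall V : nat -> set nat, uniformly_re V ->
    exists2 f : nat -> nat, recursive1 f & forall k, V k = W (f k).

Section PositiveEquivalence.
Variable eta : nat -> nat -> Prop.

Definition eta_class (x : nat) : set nat := [set y | eta x y].

Definition eta_classes : set (set nat) := range eta_class.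

Definition positive : Prop :=
  [/\ Equivalence eta, re2 eta & infinite_set eta_classes].

Definition eta_closed (A : set nat) : Prop :=
  exists D : set (set nat), D `<=` eta_classes /\ A = \bigcup_(X in D) X.

Definition eta_infinite (A : set nat) : Prop :=
  exists D : set (set nat),
    [/\ D `<=` eta_classes, infinite_set D & A = \bigcup_(X in D) X].

Definition eta_closure (A : set nat) : set nat := \bigcup_(x in A) eta_class x.

(** Infinity of the family follows from injectivity of its numbering. *)
Definition eta_family (C : set (set nat)) : Prop :=
  (forall L, C L -> eta_closed L) /\
  exists B : nat -> set nat, [/\ uniformly_re B, injective B & C = range B].

End PositiveEquivalence.

(** [None] stands for the pause symbol # in texts and for ? in outputs. *)
Definition text := nat -> option nat.
Definition learner := seq (option nat) -> option nat.

Definition content (T : text) : set nat := [set x | exists n, T n = Some x].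

Definition text_for (L : set nat) (T : text) : Prop := content T = L.

Definition prefix_of (T : text) (n : nat) : seq (option nat) := mkseq T n.

(** Bijective codings of symbols and of finite sequences, the latter built up
    from the left, so that [code_seq (rcons s a)] is
    [(Cantor.to_nat (code_seq s, code_opt a)).+1]. *)
Definition code_opt (a : option nat) : nat := if a is Some x then x.+1 else 0.

Definition code_seq (s : seq (option nat)) : nat :=
  foldl (fun c a => (Cantor.to_nat (c, code_opt a)).+1) 0 s.

Definition recursive_learner (M : learner) : Prop :=
  exists2 f : nat -> nat, recursive1 f &
    forall s, f (code_seq s) = code_opt (M s).

Definition converges_to (M : learner) (T : text) (h : option nat) : Prop :=
  exists n0, forall n, n0 <= n -> M (prefix_of T n) = h.

Section Learning.
Variables (W : nat -> set nat) (eta : nat -> nat -> Prop).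

Definition hypothesis (e : nat) : set nat := eta_closure eta (W e).

Definition explanatorily_learns (M : learner) (C : set (set nat)) : Prop :=
  forall L T, C L -> text_for L T ->
    exists e, converges_to M T (Some e) /\ hypothesis e = L.

Definition weakly_confidently_learns (M : learner) (C : set (set nat)) : Prop :=
  explanatorily_learns M C /\
  forall L T, C L -> content T `<=` L -> exists h, converges_to M T h.

Definition explanatorily_learnable (C : set (set nat)) : Prop :=
  exists2 M, recursive_learner M & explanatorily_learns M C.

Definition weakly_confidently_learnable (C : set (set nat)) : Prop :=
  exists2 M, recursive_learner M & weakly_confidently_learns M C.

End Learning.

(* Main.v *)
(* Fix q outside the class of 0.  The family consists of the unions
   [0] u [x] with x > q least in its class, and, for every other x, of the union
   of the first x + q + 1 classes ordered by their least elements; the latter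
   sets contain q and are told apart by their numbers of classes, so the
   numbering is one-one although the set of least elements is not r.e.

   Let M be a weakly confident learner.  It converges on every text over [0], so
   there is a sequence sigma over [0] after which M never changes its mind on
   data from [0].  The set Z of the x such that M changes its mind on some
   extension of sigma over [0] u [x] is r.e. and closed, and it contains all but
   at most one of the x with [0] u [x] in the family, for M must learn these
   sets.  Hence Z meets infinitely many classes, which forces Z to be everything;
   but 0 is not in Z by the choice of sigma. *)
From Stdlib Require Import RelationClasses.
From Stdlib Require Cantor.
Require Import Defs.
From mathcomp Require Import all_boot zify.
From mathcomp Require Import boolp classical_sets functions cardinality.

Set Implicit Arguments.
Unset Strict Implicit.
Unset Printing Implicit Defensive.

Local Open Scope classical_set_scope.

Arguments Cantor.to_nat : simpl never.
Arguments Cantor.of_nat : simpl never.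

(** * Recursive functions *)

Definition recursive2 (f : nat -> nat -> nat) : Prop :=
  recursive (fun v : 2.-tuple nat => f (thead v) (thead (behead_tuple v))).

Lemma recursive_ext n (f g : n.-tuple nat -> nat) :
  recursive f -> f =1 g -> recursive g.
Proof. by move=> rf /funext <-. Qed.

Lemma recursive_thead n : recursive (fun v : n.+1.-tuple nat => thead v).
Proof. exact: rec_proj. Qed.

Lemma recursive_behead n (f : n.-tuple nat -> nat) :
  recursive f -> recursive (fun v : n.+1.-tuple nat => f (behead_tuple v)).
Proof.
move=> rf; apply: (rec_comp (h := fun i v => tnth v (lift ord0 i)) rf).
  by move=> i; exact: rec_proj.
move=> v; congr f; apply: eq_from_tnth => i.
by rewrite tnth_mktuple tnth_behead; congr tnth; apply: val_inj; rewrite /= inordK ?ltnS.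
Qed.

Lemma recursive_comp1 n (f : nat -> nat) (g : n.-tuple nat -> nat) :
  recursive1 f -> recursive g -> recursive (fun v => f (g v)).
Proof.
move=> rf rg; apply: (rec_comp (h := fun=> g) rf) => // v.
by rewrite /thead tnth_mktuple.
Qed.

Lemma recursive_comp2 n (f : nat -> nat -> nat) (g h : n.-tuple nat -> nat) :
  recursive2 f -> recursive g -> recursive h ->
  recursive (fun v => f (g v) (h v)).
Proof.
move=> rf rg rh.
apply: (rec_comp (h := fun i : 'I_2 => if i == ord0 then g else h) rf).
  by move=> i; case: ifP.
move=> v; rewrite /thead tnth_behead !tnth_mktuple /=.
by congr (f _ (_ v)); rewrite ifF //; apply/eqP => /(congr1 val); rewrite /= inordK.
Qed.

Lemma behead_cons n (x : nat) (v : n.-tuple nat) :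
  behead_tuple (cons_tuple x v) = v.
Proof. exact: val_inj. Qed.

Lemma thead_cons n (x : nat) (v : n.-tuple nat) : thead (cons_tuple x v) = x.
Proof. exact: theadE. Qed.

(** With the function given as a [nat_rect] term, no recursion equations need checking at each use;
    [h] takes the parameters, the counter and the previous value. *)
Lemma recursive_prim n (g : n.-tuple nat -> nat)
    (h : n.-tuple nat -> nat -> nat -> nat) :
  recursive g ->
  recursive (fun v : n.+2.-tuple nat =>
    h (behead_tuple (behead_tuple v)) (thead v) (thead (behead_tuple v))) ->
  recursive (fun v : n.+1.-tuple nat =>
    nat_rect (fun=> nat) (g (behead_tuple v)) (h (behead_tuple v)) (thead v)).
Proof.
move=> rg rh; apply: (rec_prim rg rh) => [v|y v].
  by rewrite behead_cons thead_cons.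
by rewrite !behead_cons !thead_cons.
Qed.

Lemma recursive2_add : recursive2 addn.
Proof.
apply: (@recursive_ext 2 _ _ (@recursive_prim 1 (fun v => thead v) (fun _ _ r => r.+1) _ _)).
- exact: recursive_thead.
- by apply: (recursive_comp1 rec_succ); apply: recursive_behead; apply: recursive_thead.
- by move=> v /=; elim: (thead v) => //= n ->.
Qed.

Lemma recursive1_pred : recursive1 predn.
Proof.
apply: (@recursive_ext 1 _ _ (@recursive_prim 0 (fun=> 0) (fun _ y _ => y) _ _)).
- exact: rec_zero.
- exact: recursive_thead.
- by move=> v /=; case: (thead v).
Qed.

Lemma recursive2_sub : recursive2 subn.
Proof.
(* Recursion runs on the first argument, so the subtrahend has to come first. *)
have rs : recursive2 (fun m n => n - m).
  apply: (@recursive_ext 2 _ _ (@recursive_prim 1 (fun v => thead v) (fun _ _ r => r.-1) _ _)).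
  - exact: recursive_thead.
  - by apply: (recursive_comp1 recursive1_pred); apply: recursive_behead; apply: recursive_thead.
  - by move=> v /=; elim: (thead v) => [|n /= ->]; rewrite ?subn0 ?subnS.
apply: (recursive_comp2 rs (g := fun v : 2.-tuple nat => thead (behead_tuple v))).
  by apply: recursive_behead; apply: recursive_thead.
exact: recursive_thead.
Qed.

(** Triangular numbers, in the form used by [Cantor.to_nat], so that [pairE] holds by conversion. *)
Definition tri (n : nat) : nat := nat_rect (fun=> nat) 0 (fun i m => i.+1 + m) n.

Lemma triS n : tri n.+1 = n.+1 + tri n.
Proof. by []. Qed.

Lemma pairE x y : Cantor.to_nat (x, y) = y + tri (y + x).
Proof. by []. Qed.

Lemma recursive1_tri : recursive1 tri.
Proof.
apply: (@recursive_ext 1 _ _ (@recursive_prim 0 (fun=> 0) (fun _ i m => i.+1 + m) _ _)) => //.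
  exact: rec_zero.
apply: (recursive_comp2 recursive2_add); last first.
  by apply: recursive_behead; apply: recursive_thead.
apply: (recursive_comp1 rec_succ); exact: recursive_thead.
Qed.

Lemma recursive2_pair : recursive2 (fun x y => Cantor.to_nat (x, y)).
Proof.
have r1 : recursive (fun v : 2.-tuple nat => thead v) by apply: recursive_thead.
have r2 : recursive (fun v : 2.-tuple nat => thead (behead_tuple v)).
  by apply: recursive_behead; apply: recursive_thead.
apply: (recursive_comp2 recursive2_add r2).
apply: (recursive_comp1 recursive1_tri).
exact: (recursive_comp2 recursive2_add r2 r1).
Qed.

Definition pi1 (n : nat) : nat := (Cantor.of_nat n).1.
Definition pi2 (n : nat) : nat := (Cantor.of_nat n).2.

Lemma pi1K x y : pi1 (Cantor.to_nat (x, y)) = x.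
Proof. by rewrite /pi1 Cantor.cancel_of_to. Qed.

Lemma pi2K x y : pi2 (Cantor.to_nat (x, y)) = y.
Proof. by rewrite /pi2 Cantor.cancel_of_to. Qed.

Lemma pairK n : Cantor.to_nat (pi1 n, pi2 n) = n.
Proof. by rewrite /pi1 /pi2 -surjective_pairing Cantor.cancel_to_of. Qed.

Lemma leq_tri m n : m <= n -> tri m <= tri n.
Proof. by move=> /subnKC <-; elim: (n - m) => [|k IH]; rewrite ?addn0 // addnS /=; lia. Qed.

(** The codes on antidiagonal [k] run from [tri k] up to but excluding [tri k.+1], so the sum of the
    coordinates of [n] is the least [k] with [n < tri k.+1]. *)
Lemma recursive_antidiagonal : recursive1 (fun n => pi2 n + pi1 n).
Proof.
apply: (rec_min (g := fun v : 2.-tuple nat =>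
  (thead (behead_tuple v)).+1 - tri (thead v).+1)).
- apply: (recursive_comp2 recursive2_sub).
    apply: (recursive_comp1 rec_succ).
    by apply: recursive_behead; apply: recursive_thead.
  apply: (recursive_comp1 recursive1_tri).
  by apply: (recursive_comp1 rec_succ); apply: recursive_thead.
- move=> v; rewrite behead_cons thead_cons.
  have := pairE (pi1 (thead v)) (pi2 (thead v)); rewrite pairK triS; lia.
- move=> v y; rewrite behead_cons thead_cons => /leq_tri.
  have := pairE (pi1 (thead v)) (pi2 (thead v)); rewrite pairK; lia.
Qed.

Lemma recursive1_pi2 : recursive1 pi2.
Proof.
apply: (@recursive_ext 1 (fun v => thead v - tri (pi2 (thead v) + pi1 (thead v)))).
  apply: (recursive_comp2 recursive2_sub); first exact: recursive_thead.
  by apply: (recursive_comp1 recursive1_tri); exact: recursive_antidiagonal.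
by move=> v; rewrite -{1}[thead v]pairK pairE addnK.
Qed.

Lemma recursive1_pi1 : recursive1 pi1.
Proof.
apply: (@recursive_ext 1 (fun v => pi2 (thead v) + pi1 (thead v) - pi2 (thead v))).
  by apply: (recursive_comp2 recursive2_sub recursive_antidiagonal); exact: recursive1_pi2.
by move=> v; rewrite addKn.
Qed.

(** * Closure properties of unary recursive functions and decidable predicates *)

Definition decidable1 (P : nat -> bool) : Prop := recursive1 (fun c => P c : nat).

Section UnaryClosure.
Implicit Types f g h b : nat -> nat.

Lemma recursive1_id : recursive1 (fun c => c).
Proof. exact: recursive_thead. Qed.

Lemma recursive1_comp f g : recursive1 f -> recursive1 g -> recursive1 (fun c => f (g c)).
Proof. exact: recursive_comp1. Qed.

Lemma recursive1_const k : recursive1 (fun=> k).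
Proof. by elim: k => [|k IH]; [exact: rec_zero|exact: recursive_comp1 rec_succ IH]. Qed.

Lemma recursive1_binary (op : nat -> nat -> nat) f g :
  recursive2 op -> recursive1 f -> recursive1 g -> recursive1 (fun c => op (f c) (g c)).
Proof. exact: recursive_comp2. Qed.

Lemma recursive1_pi1_comp f : recursive1 f -> recursive1 (fun c => pi1 (f c)).
Proof. exact: (recursive1_comp recursive1_pi1). Qed.

Lemma recursive1_pi2_comp f : recursive1 f -> recursive1 (fun c => pi2 (f c)).
Proof. exact: (recursive1_comp recursive1_pi2). Qed.

Lemma recursive1_S f : recursive1 f -> recursive1 (fun c => (f c).+1).
Proof. exact: (recursive1_comp rec_succ). Qed.

Lemma recursive1_P f : recursive1 f -> recursive1 (fun c => (f c).-1).
Proof. exact: (recursive1_comp recursive1_pred). Qed.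

Lemma recursive1_pair f g :
  recursive1 f -> recursive1 g -> recursive1 (fun c => Cantor.to_nat (f c, g c)).
Proof. exact: (recursive1_binary recursive2_pair). Qed.

Lemma recursive1_add f g : recursive1 f -> recursive1 g -> recursive1 (fun c => f c + g c).
Proof. exact: (recursive1_binary recursive2_add). Qed.

Lemma recursive1_sub f g : recursive1 f -> recursive1 g -> recursive1 (fun c => f c - g c).
Proof. exact: (recursive1_binary recursive2_sub). Qed.

(** In the assumption on [h], [w] codes the triple of parameter, counter and previous value, nested
    to the left. *)
Lemma recursive1_rect (h : nat -> nat -> nat -> nat) g b :
  recursive1 g -> recursive1 b ->
  recursive1 (fun w => h (pi1 (pi1 w)) (pi2 (pi1 w)) (pi2 w)) ->
  recursive1 (fun c => nat_rect (fun=> nat) (g c) (h c) (b c)).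
Proof.
move=> rg rb rh.
apply: (@recursive1_binary (fun y c => nat_rect (fun=> nat) (g c) (h c) y) b id) => //.
  apply: (@recursive_prim 1 (fun v => g (thead v)) (fun v => h (thead v))) => //.
  have r1 : recursive (fun v : 3.-tuple nat => thead v) by exact: recursive_thead.
  have r2 : recursive (fun v : 3.-tuple nat => thead (behead_tuple v)).
    by apply: recursive_behead; exact: recursive_thead.
  have r3 : recursive (fun v : 3.-tuple nat => thead (behead_tuple (behead_tuple v))).
    exact: (recursive_behead (recursive_behead (recursive_thead 0))).
  apply: (recursive_ext (recursive_comp1 rh
    (recursive_comp2 recursive2_pair (recursive_comp2 recursive2_pair r3 r1) r2))).
  by move=> v; rewrite !(pi1K, pi2K).
exact: recursive1_id.
Qed.

Lemma recursive1_min (P : nat -> nat -> bool) f :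
  decidable1 (fun w => P (pi1 w) (pi2 w)) ->
  (forall c, P c (f c)) -> (forall c y, y < f c -> ~~ P c y) ->
  recursive1 f.
Proof.
move=> rP Pf minf.
apply: (rec_min (g := fun v : 2.-tuple nat => 1 - P (thead (behead_tuple v)) (thead v))).
- apply: (recursive_comp2 recursive2_sub).
    exact: (recursive_comp1 (recursive1_const 1) (recursive_thead 1)).
  apply: (recursive_ext (recursive_comp1 rP (recursive_comp2 recursive2_pair
    (recursive_behead (recursive_thead 0)) (recursive_thead 1)))).
  by move=> v; rewrite pi1K pi2K.
- by move=> v; rewrite behead_cons thead_cons Pf.
- by move=> v y; rewrite behead_cons thead_cons => /minf /negbTE ->.
Qed.

Lemma recursive1_iter f g b :
  recursive1 f -> recursive1 g -> recursive1 b ->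
  recursive1 (fun c => iter (b c) f (g c)).
Proof.
move=> rf rg rb; suff -> : (fun c => iter (b c) f (g c)) =
    (fun c => nat_rect (fun=> nat) (g c) (fun _ r => f r) (b c)).
  apply: recursive1_rect => //; exact: recursive1_comp rf recursive1_pi2.
by apply: funext => c; elim: (b c) => //= n ->.
Qed.

Implicit Types P Q : nat -> bool.

Lemma decidable1_not P : decidable1 P -> decidable1 (fun c => ~~ P c).
Proof.
move=> rP; suff -> : decidable1 (fun c => ~~ P c) = recursive1 (fun c => 1 - P c).
  by apply: recursive1_sub => //; exact: recursive1_const.
by congr recursive1; apply: funext => c; case: (P c).
Qed.

Lemma decidable1_leq f g : recursive1 f -> recursive1 g -> decidable1 (fun c => f c <= g c).
Proof.
move=> rf rg; suff -> : decidable1 (fun c => f c <= g c) = recursive1 (fun c => 1 - (f c - g c)).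
  by apply: recursive1_sub; [exact: recursive1_const|exact: recursive1_sub].
by congr recursive1; apply: funext => c; rewrite /leq; case: (_ - _) => //= n; rewrite subSS sub0n.
Qed.

Lemma decidable1_or P Q : decidable1 P -> decidable1 Q -> decidable1 (fun c => P c || Q c).
Proof.
move=> rP rQ; suff -> : (fun c => P c || Q c) = (fun c => 1 <= P c + Q c).
  by apply: decidable1_leq; [exact: recursive1_const|exact: recursive1_add].
by apply: funext => c; case: (P c); case: (Q c).
Qed.

Lemma decidable1_and P Q : decidable1 P -> decidable1 Q -> decidable1 (fun c => P c && Q c).
Proof.
move=> rP rQ; suff -> : (fun c => P c && Q c) = (fun c => ~~ (~~ P c || ~~ Q c)).
  by apply: decidable1_not; apply: decidable1_or; exact: decidable1_not.
by apply: funext => c; rewrite negb_or !negbK.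
Qed.

Lemma decidable1_eq f g : recursive1 f -> recursive1 g -> decidable1 (fun c => f c == g c).
Proof.
move=> rf rg; suff -> : (fun c => f c == g c) = (fun c => (f c <= g c) && (g c <= f c)).
  by apply: decidable1_and; exact: decidable1_leq.
by apply: funext => c; rewrite eqn_leq.
Qed.

Lemma recursive1_if P f g : decidable1 P -> recursive1 f -> recursive1 g ->
  recursive1 (fun c => if P c then f c else g c).
Proof.
move=> rP rf rg; suff -> : (fun c => if P c then f c else g c) =
    (fun c => nat_rect (fun=> nat) (g c) (fun _ _ => f c) (P c : nat)).
  apply: recursive1_rect => //.
  by apply: (recursive1_comp rf); apply: recursive1_pi1_comp; exact: recursive1_pi1.
by apply: funext => c; case: (P c).
Qed.

Lemma recursive1_count (P : nat -> nat -> bool) b :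
  decidable1 (fun w => P (pi1 w) (pi2 w)) -> recursive1 b ->
  recursive1 (fun c => count (P c) (iota 0 (b c))).
Proof.
move=> rP rb; suff -> : (fun c => count (P c) (iota 0 (b c))) =
    (fun c => nat_rect (fun=> nat) 0 (fun y r => r + P c y) (b c)).
  apply: recursive1_rect => //; first exact: recursive1_const.
  apply: recursive1_add; first exact: recursive1_pi2.
  exact: recursive1_comp rP recursive1_pi1.
apply: funext => c; elim: (b c) => // n IH.
by rewrite -[in LHS]addn1 iotaD count_cat IH /= addn0.
Qed.

Lemma decidable1_has (P : nat -> nat -> bool) b :
  decidable1 (fun w => P (pi1 w) (pi2 w)) -> recursive1 b ->
  decidable1 (fun c => has (P c) (iota 0 (b c))).
Proof.
move=> rP rb; suff -> : (fun c => has (P c) (iota 0 (b c))) =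
    (fun c => 1 <= count (P c) (iota 0 (b c))).
  by apply: decidable1_leq; [exact: recursive1_const|exact: recursive1_count].
by apply: funext => c; rewrite has_count.
Qed.

Lemma decidable1_all (P : nat -> nat -> bool) b :
  decidable1 (fun w => P (pi1 w) (pi2 w)) -> recursive1 b ->
  decidable1 (fun c => all (P c) (iota 0 (b c))).
Proof.
move=> rP rb; suff -> : (fun c => all (P c) (iota 0 (b c))) =
    (fun c => ~~ has (fun y => ~~ P c y) (iota 0 (b c))).
  by apply: decidable1_not; apply: decidable1_has => //; exact: decidable1_not.
by apply: funext => c; rewrite -all_predC; apply: eq_all => y /=; rewrite negbK.
Qed.

(** An unsuccessful [find] returns the length [b]; in all cases the value is the least [y] with
    [P y] or [y = b], which makes it accessible to minimization. *)
Lemma find_iotaP (P : pred nat) (b y : nat) :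
  (y == find P (iota 0 b)) = [&& y <= b, (y == b) || P y & all (predC P) (iota 0 y)].
Proof.
apply/eqP/idP => [->|/and3P[yb Py min]].
  have le := find_size P (iota 0 b); rewrite size_iota in le.
  rewrite le /=; apply/andP; split.
    case: ltngtP le => //= lt _; have := nth_find 0 (s := iota 0 b) (a := P).
    by rewrite has_find size_iota nth_iota // add0n; apply.
  apply/allP => z; rewrite mem_iota add0n /= => zlt.
  by have := before_find 0 zlt; rewrite nth_iota ?add0n ?(leq_trans zlt le) // => ->.
rewrite -[b](subnKC yb) iotaD find_cat.
have -> /= : has P (iota 0 y) = false.
  by apply/negbTE; rewrite -all_predC.
rewrite size_iota add0n; case/orP: Py => [/eqP <-|Py]; first by rewrite subnn addn0.
by case: (b - y) => [|k] /=; rewrite ?Py addn0.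
Qed.

Lemma find_iota_eq (P : pred nat) (b y : nat) :
  y < b -> P y -> (forall z, z < y -> ~~ P z) -> find P (iota 0 b) = y.
Proof.
move=> yb Py min; apply/esym/eqP; rewrite find_iotaP (ltnW yb) Py orbT /=.
by apply/allP => z; rewrite mem_iota => /min.
Qed.

Lemma recursive1_find (P : nat -> nat -> bool) b :
  decidable1 (fun w => P (pi1 w) (pi2 w)) -> recursive1 b ->
  recursive1 (fun c => find (P c) (iota 0 (b c))).
Proof.
move=> rP rb; apply: (@recursive1_min (fun c y => P c y || (y == b c))).
- apply: decidable1_or => //; apply: decidable1_eq; first exact: recursive1_pi2.
  exact: recursive1_comp rb recursive1_pi1.
- by move=> c; have := find_iotaP (P c) (b c) (find (P c) (iota 0 (b c)));
    rewrite eqxx orbC => /esym/and3P[].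
- move=> c y ylt; have := find_iotaP (P c) (b c) (find (P c) (iota 0 (b c))).
  rewrite eqxx => /esym/and3P[leb _ /allP/(_ y)].
  rewrite mem_iota /= => /(_ ylt) /negbTE ->.
  by rewrite ltn_eqF // (leq_trans ylt).
Qed.

End UnaryClosure.

(** Handles pairing, arithmetic and Boolean operations; bounded searches and composition with an
    arbitrary recursive function are left to be applied by hand. *)
Ltac solve_recursive :=
  repeat match goal with
  | |- decidable1 _ => assumption
  | |- decidable1 (fun c => ~~ @?P c) => apply: decidable1_not
  | |- decidable1 (fun c => @?P c || @?Q c) => apply: decidable1_or
  | |- decidable1 (fun c => @?P c && @?Q c) => apply: decidable1_and
  | |- decidable1 (fun c => @?f c == @?g c) => apply: decidable1_eq
  | |- decidable1 (fun c => @?f c <= @?g c) => apply: decidable1_leq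
  | |- recursive1 _ => first
    [ assumption | exact: recursive1_id | apply: recursive1_const
    | apply: recursive1_pi1_comp | apply: recursive1_pi2_comp
    | apply: recursive1_S | apply: recursive1_P | apply: recursive1_if
    | apply: recursive1_pair | apply: recursive1_add | apply: recursive1_sub ]
  end.

(** * Recursively enumerable sets *)

(** Monotonicity allows the finitely many stages to be replaced by a single later one. *)
Lemma exists_stage (P : nat -> nat -> Prop) b :
  (forall y s s', s <= s' -> P y s -> P y s') ->
  (forall y, y < b -> exists s, P y s) -> exists s, forall y, y < b -> P y s.
Proof.
move=> mono; elim: b => [|b IH] ex; first by exists 0.
have [s Ps] := IH (fun y yb => ex y (ltnW yb)).
have [t Pt] := ex b (ltnSn b).
exists (s + t) => y; rewrite ltnS leq_eqVlt => /orP[/eqP ->|yb].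
  exact: mono (leq_addl _ _) Pt.
exact: mono (leq_addr _ _) (Ps _ yb).
Qed.

(** The projection form of enumerability: a position in the enumeration serves as witness, and
    conversely all pairs of an element and a witness are enumerated. *)
Lemma reP (A : set nat) :
  re A <-> exists P : nat -> nat -> bool,
    decidable1 (fun w => P (pi1 w) (pi2 w)) /\ forall x, A x <-> exists w, P x w.
Proof.
split=> [[->|[f rf ->]]|[P [rP AP]]].
- by exists (fun _ _ => false); split=> [|x]; [exact: recursive1_const|split=> // -[]].
- exists (fun x n => f n == x); split.
    apply: decidable1_eq; last exact: recursive1_pi1.
    exact: recursive1_comp rf recursive1_pi2.
  by move=> x; split=> [[n _ <-]|[n /eqP <-]]; exists n.
- have [->|/set0P[x0 Ax0]] := eqVneq A set0; [by left|right].
  (* Pairs that fail the test are sent to [x0], which keeps the enumeration total and inside [A]. *)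
  exists (fun w => if P (pi1 w) (pi2 w) then pi1 w else x0).
    by solve_recursive.
  apply/seteqP; split=> [x /AP[w Pxw]|_ [w _ <-]].
    by exists (Cantor.to_nat (x, w)) => //=; rewrite pi1K pi2K Pxw.
  by case: ifPn => // Pw; apply/AP; exists (pi2 w).
Qed.

Lemma re_ext (A B : set nat) : re A -> (forall x, A x <-> B x) -> re B.
Proof. by move=> reA AB; suff <- : A = B by []; apply/seteqP; split=> x /AB. Qed.

Lemma re_decidable1 (P : nat -> bool) : decidable1 P -> re [set x | P x].
Proof.
move=> rP; apply/reP; exists (fun x _ => P x); split.
  exact: recursive1_comp rP recursive1_pi1.
by move=> x; split=> [Px|[]//]; exists 0.
Qed.

Lemma re_preimage (A : set nat) f : re A -> recursive1 f -> re [set x | A (f x)].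
Proof.
move=> /reP[P [rP AP]] rf; apply/reP; exists (fun x => P (f x)); split=> [|x]; last exact: AP.
have r : recursive1 (fun w => Cantor.to_nat (f (pi1 w), pi2 w)).
  by solve_recursive; exact: recursive1_comp rf recursive1_pi1.
have := recursive1_comp rP r; congr recursive1.
by apply: funext => w; rewrite pi1K pi2K.
Qed.

Lemma re_setI (A B : set nat) : re A -> re B -> re (A `&` B).
Proof.
move=> /reP[P [rP AP]] /reP[Q [rQ BQ]]; apply/reP.
exists (fun x w => P x (pi1 w) && Q x (pi2 w)); split.
  apply: decidable1_and.
    have r : recursive1 (fun w => Cantor.to_nat (pi1 w, pi1 (pi2 w))) by solve_recursive.
    have := recursive1_comp rP r; congr recursive1.
    by apply: funext => w; rewrite pi1K pi2K.
  have r : recursive1 (fun w => Cantor.to_nat (pi1 w, pi2 (pi2 w))) by solve_recursive.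
  have := recursive1_comp rQ r; congr recursive1.
  by apply: funext => w; rewrite pi1K pi2K.
move=> x; split=> [[/AP[w Pw] /BQ[w' Qw']]|[w /andP[Pw Qw]]].
  by exists (Cantor.to_nat (w, w')); rewrite pi1K pi2K Pw.
by split; [apply/AP; exists (pi1 w)|apply/BQ; exists (pi2 w)].
Qed.

Lemma re_setU (A B : set nat) : re A -> re B -> re (A `|` B).
Proof.
move=> /reP[P [rP AP]] /reP[Q [rQ BQ]]; apply/reP.
exists (fun x w => P x w || Q x w); split; first exact: decidable1_or.
move=> x; split=> [[/AP[w Pw]|/BQ[w Qw]]|[w /orP[Pw|Qw]]].
- by exists w; rewrite Pw.
- by exists w; rewrite Qw orbT.
- by left; apply/AP; exists w.
- by right; apply/BQ; exists w.
Qed.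

Lemma re_exists (R : nat -> nat -> Prop) :
  re [set w | R (pi1 w) (pi2 w)] -> re [set x | exists y, R x y].
Proof.
move=> /reP[P [rP AP]]; apply/reP.
exists (fun x w => P (Cantor.to_nat (x, pi1 w)) (pi2 w)); split.
  have r : recursive1 (fun w => Cantor.to_nat (Cantor.to_nat (pi1 w, pi1 (pi2 w)), pi2 (pi2 w))).
    by solve_recursive.
  have := recursive1_comp rP r; congr recursive1.
  by apply: funext => w; rewrite pi1K pi2K.
move=> x; split=> [[y Rxy]|[w Pw]].
  have /AP[w Pw] : [set w | R (pi1 w) (pi2 w)] (Cantor.to_nat (x, y)) by rewrite /= pi1K pi2K.
  by exists (Cantor.to_nat (y, w)); rewrite pi1K pi2K.
exists (pi1 w); have : [set w | R (pi1 w) (pi2 w)] (Cantor.to_nat (x, pi1 w)).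
  by apply/AP; exists (pi2 w).
by rewrite /= pi1K pi2K.
Qed.

(** The witnesses for all [y < b x] have a common bound [s] by [exists_stage], and for a given [s]
    the test is a decidable double bounded search. *)
Lemma re_bounded_forall (R : nat -> nat -> Prop) b :
  recursive1 b -> re [set w | R (pi1 w) (pi2 w)] ->
  re [set x | forall y, y < b x -> R x y].
Proof.
move=> rb /reP[P [rP AP]]; apply/reP.
have RP x y : R x y <-> exists s, P (Cantor.to_nat (x, y)) s.
  by rewrite -AP /= pi1K pi2K.
exists (fun x s => all (fun y => has (P (Cantor.to_nat (x, y))) (iota 0 s)) (iota 0 (b x))); split.
  apply: decidable1_all; last exact: recursive1_comp rb recursive1_pi1.
  apply: decidable1_has; last by solve_recursive.
  have r : recursive1 (fun w => Cantor.to_nat (Cantor.to_nat (pi1 (pi1 (pi1 w)), pi2 (pi1 w)), pi2 w)).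
    by solve_recursive.
  have := recursive1_comp rP r; congr recursive1.
  by apply: funext => w; rewrite pi1K pi2K.
move=> x; split=> [Rx|[s /allP Ps] y yb].
  have [||s Ps] := @exists_stage (fun y s => has (P (Cantor.to_nat (x, y))) (iota 0 s)) (b x).
  - move=> y s s' le /hasP[w]; rewrite mem_iota /= => ws Pw; apply/hasP; exists w => //.
    by rewrite mem_iota /= (leq_trans ws le).
  - move=> y /Rx /RP[s Ps]; exists s.+1; apply/hasP; exists s => //.
    by rewrite mem_iota /= add0n ltnS.
  by exists s; apply/allP => y; rewrite mem_iota add0n => /Ps.
have := Ps y; rewrite mem_iota => /(_ yb)/hasP[w _ Pw].
by apply/RP; exists w.
Qed.

Lemma re2E (R : nat -> nat -> Prop) : re2 R <-> re [set w | R (pi1 w) (pi2 w)].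
Proof.
rewrite /re2; suff -> : [set z | exists x y, z = Cantor.to_nat (x, y) /\ R x y] =
  [set w | R (pi1 w) (pi2 w)] by [].
apply/seteqP; split=> [_ [x [y [-> Rxy]]]|w Rw] /=; first by rewrite pi1K pi2K.
by exists (pi1 w), (pi2 w); rewrite pairK.
Qed.

Lemma re2_comp (R : nat -> nat -> Prop) f g :
  re2 R -> recursive1 f -> recursive1 g -> re [set x | R (f x) (g x)].
Proof.
move=> /re2E reR rf rg.
apply: (re_ext (re_preimage reR (recursive1_pair rf rg))) => x.
by rewrite /= pi1K pi2K.
Qed.

(** * Texts and codes of sequences *)

Definition code_belast (c : nat) : nat := pi1 c.-1.
Definition code_last (c : nat) : nat := pi2 c.-1.

Lemma code_seq_rcons s a :
  code_seq (rcons s a) = (Cantor.to_nat (code_seq s, code_opt a)).+1.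
Proof. by rewrite /code_seq foldl_rcons. Qed.

Lemma code_belast_rcons s a : code_belast (code_seq (rcons s a)) = code_seq s.
Proof. by rewrite /code_belast code_seq_rcons pi1K. Qed.

Lemma code_last_rcons s a : code_last (code_seq (rcons s a)) = code_opt a.
Proof. by rewrite /code_last code_seq_rcons pi2K. Qed.

Lemma code_opt_inj : injective code_opt.
Proof. by case=> [x|] [y|] //= [->]. Qed.

Lemma code_seq_inj : injective code_seq.
Proof.
elim/last_ind=> [|s a IH] t; case/lastP: t => [|t b] //; rewrite !code_seq_rcons // => -[].
by move/Cantor.to_nat_inj => -[/IH -> /code_opt_inj ->].
Qed.

(** Every number found by an unbounded search can thus be decoded. Strong induction applies because
    a coordinate never exceeds the code of its pair. *)
Lemma code_seq_surj c : exists s, code_seq s = c.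
Proof.
elim/ltn_ind: c => -[_|c IH]; first by exists [::].
have [|s sc] := IH (pi1 c).
  by have := Cantor.to_nat_non_decreasing (pi1 c) (pi2 c); rewrite pairK; lia.
exists (rcons s (if pi2 c is x.+1 then Some x else None)).
rewrite code_seq_rcons sc -[in RHS](pairK c); congr (Cantor.to_nat (_, _)).+1.
by case: (pi2 c).
Qed.

(** Makes the code of a sequence a bound for searches through its positions. *)
Lemma size_code_seq s : size s <= code_seq s.
Proof.
elim/last_ind: s => // s a IH; rewrite size_rcons code_seq_rcons ltnS.
by have := Cantor.to_nat_non_decreasing (code_seq s) (code_opt a); lia.
Qed.

Lemma iter_code_belast_cat s t : iter (size t) code_belast (code_seq (s ++ t)) = code_seq s.
Proof.
elim/last_ind: t => [|t a IH]; first by rewrite cats0.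
by rewrite size_rcons iterSr -rcons_cat code_belast_rcons.
Qed.

(** The case [k > size s] is covered too: the subtraction is truncated, and the code 0 of the empty
    sequence is a fixed point of [code_belast]. *)
Lemma iter_code_belast k s : iter k code_belast (code_seq s) = code_seq (take (size s - k) s).
Proof.
have [ks|sk] := leqP k (size s).
  have := iter_code_belast_cat (take (size s - k) s) (drop (size s - k) s).
  by rewrite cat_take_drop size_drop subKn.
have /eqP -> : size s - k == 0 by rewrite subn_eq0 ltnW.
rewrite take0 -(subnK (ltnW sk)) iterD.
have -> : iter (size s) code_belast (code_seq s) = 0 by rewrite (iter_code_belast_cat [::] s).
have belast0 : code_belast 0 = 0 by rewrite /code_belast /= -[0]/(Cantor.to_nat (0, 0)) pi1K.
by elim: (k - size s) => //= n ->.
Qed.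

(** Positions are counted from the end, as [code_belast] strips symbols there. Past the beginning of
    [s] both sides are 0, the code of a pause. *)
Lemma code_last_iter k s :
  code_last (iter k code_belast (code_seq s)) = code_opt (nth None (rev s) k).
Proof.
rewrite iter_code_belast; have [ks|sk] := ltnP k (size s); last first.
  by rewrite nth_default ?size_rev // (eqP (_ : size s - k == 0)) // take0.
rewrite nth_rev // -[in LHS]subSS subSn //.
by rewrite (take_nth None) ?code_last_rcons //; lia.
Qed.

(** The bound [c] exceeds what is needed; surplus positions read as 0 and never equal [x.+1]. *)
Definition occurs (x c : nat) : bool :=
  has (fun k => code_last (iter k code_belast c) == x.+1) (iota 0 c).

Lemma occursP x s : occurs x (code_seq s) = (Some x \in s).
Proof.
rewrite -mem_rev; apply/hasP/idP => [[k _]|].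
  rewrite code_last_iter; case E : (nth None (rev s) k) => [y|] //= /eqP[<-].
  rewrite -E mem_nth // ltnNge; apply/negP => le.
  by rewrite nth_default in E.
move=> xs; exists (index (Some x) (rev s)); last by rewrite code_last_iter nth_index.
rewrite mem_iota /=; apply: leq_trans (size_code_seq s).
by rewrite -size_rev index_mem.
Qed.

Lemma recursive1_code_belast : recursive1 code_belast.
Proof. by rewrite /code_belast; solve_recursive. Qed.

Lemma recursive1_code_last : recursive1 code_last.
Proof. by rewrite /code_last; solve_recursive. Qed.

Lemma decidable1_occurs f g : recursive1 f -> recursive1 g ->
  decidable1 (fun c => occurs (f c) (g c)).
Proof.
move=> rf rg; apply: decidable1_has => //; apply: decidable1_eq.
  apply: (recursive1_comp recursive1_code_last).
  apply: (recursive1_iter recursive1_code_belast); last exact: recursive1_pi2.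
  exact: recursive1_comp rg recursive1_pi1.
apply: recursive1_S; exact: recursive1_comp rf recursive1_pi1.
Qed.

(** * Prefixes of texts, and texts extending a given sequence *)

Section Texts.
Variables (T : text).

Lemma mem_prefix x n : Some x \in prefix_of T n <-> exists2 i, i < n & T i = Some x.
Proof.
split=> [/mapP[i]|[i ilt <-]]; first by rewrite mem_iota => ilt ->; exists i.
by apply: map_f; rewrite mem_iota.
Qed.

Lemma prefix_content x n : Some x \in prefix_of T n -> content T x.
Proof. by move/mem_prefix => [i _ Ti]; exists i. Qed.

Lemma content_prefix b : exists n0, forall n, n0 <= n ->
  forall y, y < b -> content T y -> Some y \in prefix_of T n.
Proof.
have [||n0 Pn0] := @exists_stage (fun y n => content T y -> Some y \in prefix_of T n) b.
- move=> y s s' le P /P /mem_prefix[i ilt Ti]; apply/mem_prefix; exists i => //.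
  exact: leq_trans ilt le.
- move=> y _; have [[i Ti]|nT] := pselect (content T y); last by exists 0.
  by exists i.+1 => _; apply/mem_prefix; exists i.
by exists n0 => n le y /Pn0 P /P /mem_prefix[i ilt Ti]; apply/mem_prefix; exists i => //;
  exact: leq_trans ilt le.
Qed.

End Texts.

Section Extend.
Variables (sigma : seq (option nat)) (L : set nat).

(** The case distinction is classical: this text need not be recursive, as a learner has to succeed
    on all texts. *)
Definition extend_text : text := fun n =>
  if n < size sigma then nth None sigma n
  else if `[< L (n - size sigma) >] then Some (n - size sigma) else None.

Lemma prefix_extend n : size sigma <= n ->
  exists2 tau, prefix_of extend_text n = sigma ++ tau & forall x, Some x \in tau -> L x.
Proof.
move=> le; exists [seq extend_text i | i <- iota (size sigma) (n - size sigma)].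
  rewrite /prefix_of /mkseq -{1}(subnKC le) iotaD map_cat; congr (_ ++ _).
  apply: (@eq_from_nth _ None); rewrite size_map size_iota // => i ilt.
  by rewrite (nth_map 0) ?size_iota // nth_iota // /extend_text add0n ilt.
move=> x /mapP[i]; rewrite mem_iota => /andP[ge _]; rewrite /extend_text ltnNge ge /=.
by case: ifPn => // /asboolP Li [->].
Qed.

Lemma content_extend : (forall x, Some x \in sigma -> L x) -> content extend_text = L.
Proof.
move=> sL; apply/seteqP; split=> [x [n]|x Lx].
  rewrite /extend_text; case: ifP => [nlt E|_]; first by apply: sL; rewrite -E mem_nth.
  by case: ifPn => // /asboolP Li [<-].
exists (size sigma + x); rewrite /extend_text ltnNge leq_addr addKn.
by case: asboolP.
Qed.

End Extend.

(* If every sequence over L had an extension over L on which M changes its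
   mind, then chaining these extensions would give a text on which M diverges. *)
Lemma stabilizing_sequence (M : learner) (L : set nat) :
  (forall T, content T `<=` L -> exists h, converges_to M T h) ->
  exists2 sigma, forall x, Some x \in sigma -> L x &
    forall tau, (forall x, Some x \in tau -> L x) -> M (sigma ++ tau) = M sigma.
Proof.
move=> conv; apply: contrapT => nostab.
(* The condition on [s] is placed under the quantifier so that [choice] gives a total function
   [next]. *)
have step s : exists t, (forall x, Some x \in s -> L x) ->
    (forall x, Some x \in t -> L x) /\ M (s ++ t) <> M s.
  have [sL|nsL] := pselect (forall x, Some x \in s -> L x); last by exists [::].
  apply: contrapT => not; apply: nostab; exists s => // t tL.
  by apply: contrapT => neq; apply: not; exists t.
have [next nextP] := choice step.
pose sig k := iter k (fun s => s ++ next s) [::].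
have sigS k : sig k.+1 = sig k ++ next (sig k) by [].
have sigL k x : Some x \in sig k -> L x.
  elim: k x => // k IH x; rewrite sigS mem_cat => /orP[/IH //|].
  exact: (nextP _ IH).1.
have sig_neq k : M (sig k.+1) <> M (sig k) by apply: (nextP _ (sigL k)).2.
(* A change of mind requires a nonempty extension, so the lengths grow strictly. *)
have sig_size k : k <= size (sig k).
  elim: k => // k IH; rewrite sigS size_cat.
  case E : (next (sig k)) => [|a t]; last by rewrite addnS ltnS (leq_trans IH) ?leq_addr.
  by have := @sig_neq k; rewrite sigS E cats0.
have sig_take k j : k <= j -> sig k = take (size (sig k)) (sig j).
  move=> /subnKC <-; elim: (j - k) => [|i IH]; first by rewrite addn0 take_size.
  rewrite addnS sigS takel_cat // [in X in size X]IH size_take_min; exact: geq_minr.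
(* By [sig_size] position [n] exists in [sig n.+1], so the default of [nth] is never taken. *)
pose T n := nth None (sig n.+1) n.
have prefT k : prefix_of T (size (sig k)) = sig k.
  apply: (@eq_from_nth _ None); rewrite size_mkseq // => i ilt.
  rewrite nth_mkseq // /T; have [le|lt] := leqP k i.+1.
    by rewrite [in RHS](sig_take _ _ le) nth_take.
  by rewrite (sig_take _ _ (ltnW lt)) nth_take // (leq_trans (ltnSn _)).
have [|h [n0 hP]] := conv T.
  by move=> x [n Tn]; apply: (sigL n.+1); rewrite -Tn mem_nth // (leq_trans (ltnSn _)).
(* Both [sig n0] and [sig n0.+1] are prefixes of [T] of length at least [n0], where the output is
   already constant. *)
apply: (@sig_neq n0).
rewrite -[sig n0.+1]prefT -[in RHS]prefT !hP //.
exact: leq_trans (leqnSn _) (sig_size _).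
Qed.

(** * Least representatives *)

Section Representatives.
Variable eta : nat -> nat -> Prop.
Hypothesis heta : positive eta.

Let eta_equiv : Equivalence eta. Proof. by case: heta. Qed.
Let etaxx x : eta x x. Proof. exact: Equivalence_Reflexive. Qed.
Let eta_sym x y : eta x y -> eta y x. Proof. exact: Equivalence_Symmetric. Qed.
Let eta_trans x y z : eta x y -> eta y z -> eta x z.
Proof. exact: Equivalence_Transitive. Qed.

Definition saturated (A : set nat) : Prop := forall x y, A x -> eta x y -> A y.

Lemma saturated_bigcup (A : set nat) :
  saturated A -> A = \bigcup_(X in eta_class eta @` A) X.
Proof.
move=> sA; apply/seteqP; split=> [x Ax|x [_ [y Ay <-] yx]]; last exact: sA Ay yx.
by exists (eta_class eta x) => //; exists x.
Qed.

Lemma saturated_closed (A : set nat) : saturated A -> eta_closed eta A.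
Proof.
move=> sA; exists (eta_class eta @` A); split; last exact: saturated_bigcup.
by move=> _ [x _ <-]; exists x.
Qed.

Lemma eta_class_eq x y : eta x y -> eta_class eta x = eta_class eta y.
Proof.
move=> xy; apply/seteqP; split=> z; first exact: eta_trans (eta_sym xy).
exact: eta_trans xy.
Qed.

Definition minimal (u : nat) : bool := `[< forall v, v < u -> ~ eta v u >].

Lemma minimalPn u : ~~ minimal u <-> exists2 v, v < u & eta v u.
Proof.
split=> [|[v vu evu]]; last by apply/negP => /asboolP /(_ v vu).
move/asboolPn => /existsNP[v /not_implyP[vu /contrapT evu]].
by exists v.
Qed.

Lemma minimal_eq u v : minimal u -> minimal v -> eta u v -> u = v.
Proof.
move=> /asboolP mu /asboolP mv uv; case: (ltngtP u v) => // lt.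
  by case: (mv u lt).
by case: (mu v lt); exact: eta_sym.
Qed.

Lemma minimal_rep x : exists2 u, minimal u & eta u x.
Proof.
have ex : exists u, `[< eta u x >] by exists x; apply/asboolP; exact: etaxx.
case: (ex_minnP ex) => u /asboolP ux umin; exists u => //; apply/asboolP => v vu evu.
have := umin v (asboolT (eta_trans evu ux)); rewrite leqNgt vu.
by [].
Qed.

(** Each class is counted at its least element, so this is the number of classes that meet [[0, y)];
    at a minimal [y] it is the rank of the class of [y]. *)
Definition nclasses (y : nat) : nat := count minimal (iota 0 y).

Lemma nclassesS y : nclasses y.+1 = nclasses y + minimal y.
Proof. by rewrite /nclasses -[in LHS]addn1 iotaD count_cat /= addn0. Qed.

Lemma leq_nclasses x y : x <= y -> nclasses x <= nclasses y.
Proof. by move=> /subnKC <-; rewrite /nclasses iotaD count_cat leq_addr. Qed.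

Lemma nclasses_leq y : nclasses y <= y.
Proof. by rewrite /nclasses -{2}(size_iota 0 y) count_size. Qed.

(** Otherwise every class would have its least element below [N], leaving only finitely many
    classes. *)
Lemma minimal_unbounded N : exists2 u, N <= u & minimal u.
Proof.
apply: contrapT => not; case: heta => _ _; apply.
apply: (sub_finite_set _ (finite_image (eta_class eta) (finite_II N))).
move=> _ [x _ <-]; have [u mu ux] := minimal_rep x.
exists u; last exact: eta_class_eq.
by rewrite /= ltnNge; apply/negP => Nu; apply: not; exists u.
Qed.

(** The least minimal [u >= N] works: nothing from [N] up to [u] is minimal, so the count stays the
    same. *)
Lemma next_minimal N : exists u, [/\ minimal u, N <= u & nclasses u = nclasses N].
Proof.
have ex : exists u, (N <= u) && minimal u.
  by have [u Nu mu] := minimal_unbounded N; exists u; rewrite Nu.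
case: (ex_minnP ex) => u /andP[Nu mu] umin; exists u; split=> //.
rewrite -(subnKC Nu) /nclasses iotaD count_cat add0n [X in _ + X](_ : _ = 0) ?addn0 //.
apply/eqP; rewrite -leqn0 leqNgt -has_count; apply/hasPn => v.
rewrite mem_iota subnKC // => /andP[Nv]; apply: contraTN => mv.
by rewrite -leqNgt umin // Nv.
Qed.

Lemma minimal_of_nclasses m : exists2 u, minimal u & nclasses u = m.
Proof.
elim: m => [|m [u mu <-]]; first by have [u [mu _ nu]] := next_minimal 0; exists u.
have [v [mv _ nv]] := next_minimal u.+1; exists v => //.
by rewrite nv nclassesS mu addn1.
Qed.

(* The union of the first [m.+1] classes, ordered by their least elements. *)
Definition init_classes (m : nat) : set nat := [set z | exists2 y, eta y z & nclasses y <= m].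

Lemma init_classes_saturated m : saturated (init_classes m).
Proof. by move=> x y [z zx le] xy; exists z => //; exact: eta_trans xy. Qed.

(** A witness [y] for membership need not be minimal, but it is equivalent to [u] and hence at least
    [u]; monotonicity of [nclasses] does the rest. *)
Lemma minimal_init_classes m u : minimal u -> init_classes m u <-> nclasses u <= m.
Proof.
move=> /asboolP mu; split=> [[y yu]|le]; last by exists u.
by apply: leq_trans; apply: leq_nclasses; rewrite leqNgt; apply/negP => /mu.
Qed.

Lemma mem_init_classes m y : y <= m -> init_classes m y.
Proof. by move=> le; exists y => //; exact: leq_trans (nclasses_leq y) le. Qed.

(** The minimal element of rank [m] lies in [init_classes n] only if [m <= n]. *)
Lemma init_classes_inj : injective init_classes.
Proof.
have le m n : init_classes m = init_classes n -> m <= n.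
  have [u mu <-] := minimal_of_nclasses m.
  by move=> eq; apply/(minimal_init_classes _ mu); rewrite -eq; apply/minimal_init_classes.
by move=> m n eq; apply/eqP; rewrite eqn_leq !le.
Qed.

(** Here [w] is the least number missing from the set. It has [nclasses w > m], so every [y] with
    [nclasses y <= m] is below [w]. A learner can thus name the set once it has found [w]. *)
Lemma closure_init_classes m : exists w,
  [/\ ~ init_classes m w, forall y, y < w -> init_classes m y
    & eta_closure eta [set x | x < w] = init_classes m].
Proof.
have ex : exists w, `[< ~ init_classes m w >].
  have [u mu nu] := minimal_of_nclasses m.+1; exists u; apply/asboolP.
  by move/(minimal_init_classes _ mu); rewrite nu ltnn.
case: (ex_minnP ex) => w /asboolP nw wmin.
have lew y : y < w -> init_classes m y.
  move=> yw; apply: contrapT => ny.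
  by have := wmin y (asboolT ny); rewrite leqNgt yw.
exists w; split=> //; apply/seteqP; split=> [z [y /lew By yz]|z [y yz le]].
  exact: init_classes_saturated By yz.
exists y => //=; rewrite ltnNge; apply/negP => wy; apply: nw; exists w => //.
exact: leq_trans (leq_nclasses wy) le.
Qed.

(** Stage [s] accepts the pairs with a witness below [s], which gives increasing decidable
    approximations to [eta]. *)
Lemma re2_bool : exists2 E : nat -> nat -> nat -> bool,
  decidable1 (fun w => E (pi1 w) (pi1 (pi2 w)) (pi2 (pi2 w))) &
  (forall u v, eta u v <-> exists s, E s u v) /\
  (forall s s' u v, s <= s' -> E s u v -> E s' u v).
Proof.
case: heta => _ /re2E /reP[P [rP etaP]] _.
exists (fun s u v => has (P (Cantor.to_nat (u, v))) (iota 0 s)).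
  apply: decidable1_has; last exact: recursive1_pi1.
  have r : recursive1 (fun w => Cantor.to_nat (Cantor.to_nat
     (pi1 (pi2 (pi1 w)), pi2 (pi2 (pi1 w))), pi2 w)).
    by solve_recursive.
  have := recursive1_comp rP r; congr recursive1.
  by apply: funext => w; rewrite pi1K pi2K.
split=> [u v|s s' u v le /hasP[w]].
  have := etaP (Cantor.to_nat (u, v)); rewrite /= pi1K pi2K => ->.
  split=> [[w Pw]|[s /hasP[w _ Pw]]]; last by exists w.
  by exists w.+1; apply/hasP; exists w; rewrite ?mem_iota /=.
rewrite mem_iota => ws Pw; apply/hasP; exists w => //.
by rewrite mem_iota (leq_trans ws).
Qed.

(** Minimality can only be refuted in finite time, so counting the numbers not yet refuted
    approximates [nclasses] from above and reaches it at some stage. Upper bounds on [nclasses] are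
    therefore enumerable. *)
Lemma re_nclasses : re2 (fun y m => nclasses y <= m).
Proof.
have [E rE [EP Emono]] := re2_bool.
pose news s u := ~~ has (fun v => E s v u) (iota 0 u).
pose nstage s y := count (news s) (iota 0 y).
have r_stage : decidable1 (fun w => nstage (pi2 w) (pi1 (pi1 w)) <= pi2 (pi1 w)).
  apply: decidable1_leq; last by solve_recursive.
  apply: recursive1_count; last by solve_recursive.
  apply: decidable1_not; apply: decidable1_has; last by solve_recursive.
  have r : recursive1 (fun w => Cantor.to_nat (pi2 (pi1 (pi1 w)),
      Cantor.to_nat (pi2 w, pi2 (pi1 w)))) by solve_recursive.
  have := recursive1_comp rE r; congr recursive1.
  by apply: funext => w; rewrite !(pi1K, pi2K).
apply/re2E; apply: (re_ext (re_exists
  (R := fun x s => nstage s (pi1 x) <= pi2 x) _)).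
  exact: re_decidable1 r_stage.
have newsN s u : minimal u -> news s u.
  move=> /asboolP mu; apply/hasPn => v; rewrite mem_iota /= => vu; apply/negP => Evu.
  by apply: (mu v vu); apply/EP; exists s.
move=> x /=; split=> [[s]|le].
  by apply: leq_trans; apply: sub_count => u; exact: newsN.
(* A stage by which all nonminimal numbers below [pi1 x] are refuted. *)
have [||s sP] := @exists_stage (fun u s => news s u -> minimal u) (pi1 x).
- move=> u s s' ss' imp nu; apply: imp; apply: contraNN nu => /hasP[v vu Evu].
  by apply/hasP; exists v => //; exact: Emono Evu.
- move=> u _; have [mu|/minimalPn[v vu /EP[s Evu]]] := boolP (minimal u); first by exists 0.
  by exists s => /hasPn/(_ v); rewrite mem_iota Evu => /(_ vu).
exists s; apply: leq_trans le; rewrite /nstage /nclasses.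
rewrite (@eq_in_count _ (news s) minimal) // => u; rewrite mem_iota => /sP imp.
by apply/idP/idP => //; exact: newsN.
Qed.

Lemma re_eta f g : recursive1 f -> recursive1 g -> re [set x | eta (f x) (g x)].
Proof. by case: heta => _ reta _; exact: re2_comp. Qed.

End Representatives.

(** * The family *)

Section Family.
Variables (W : nat -> set nat) (eta : nat -> nat -> Prop) (q : nat).
Hypotheses (hW : acceptable W) (heta : positive eta) (eta0q : ~ eta 0 q).

Let eta_equiv : Equivalence eta. Proof. by case: heta. Qed.
Let etaxx x : eta x x. Proof. exact: Equivalence_Reflexive. Qed.
Let eta_sym x y : eta x y -> eta y x. Proof. exact: Equivalence_Symmetric. Qed.
Let eta_trans x y z : eta x y -> eta y z -> eta x z.
Proof. exact: Equivalence_Transitive. Qed.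

Definition two_classes (x : nat) : set nat := [set z | eta 0 z \/ eta x z].

Definition good (x : nat) : bool := (q < x) && minimal eta x.

Definition family (x : nat) : set nat :=
  if good x then two_classes x else init_classes eta (x + q).

Lemma two_classes_saturated x : saturated eta (two_classes x).
Proof. by move=> y z [] yz zw; [left|right]; exact: eta_trans zw. Qed.

Lemma good_neq0 x : good x -> ~ eta 0 x.
Proof. by move=> /andP[qx /asboolP]; apply; exact: leq_ltn_trans qx. Qed.

Lemma good_notin_q x : good x -> ~ two_classes x q.
Proof.
by move=> /andP[qx /asboolP mx] [//|/eta_sym]; exact: mx.
Qed.

Lemma family_saturated x : saturated eta (family x).
Proof.
rewrite /family; case: ifP => _; first exact: two_classes_saturated.
exact: init_classes_saturated.
Qed.

Lemma two_classes_inj x y : good x -> good y -> two_classes x = two_classes y -> x = y.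
Proof.
move=> gx gy eq; have : two_classes y x by rewrite -eq; right.
case=> [/(good_neq0 gx)//|yx]; case/andP: gx => _ mx; case/andP: gy => _ my.
exact: (minimal_eq heta mx my (eta_sym yx)).
Qed.

Lemma family_inj : injective family.
Proof.
move=> x y; rewrite /family.
(* Membership of [q] separates the two kinds of sets: the summand [q] puts it into those of the
   second kind, and [good_notin_q] keeps it out of the first. *)
have bad z : init_classes eta (z + q) q by exact: mem_init_classes (leq_addl _ _).
case: ifPn => gx; case: ifPn => gy.
- exact: two_classes_inj.
- by move=> eq; have := bad y; rewrite -eq => /(good_notin_q gx).
- by move=> eq; have := bad x; rewrite eq => /(good_notin_q gy).
- by move/(init_classes_inj heta)/addIn.
Qed.

Lemma re_init_classes : re2 (init_classes eta).
Proof.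
apply/re2E; apply: (re_ext (re_exists
  (R := fun w y => eta y (pi2 w) /\ nclasses eta y <= pi1 w) _)).
  apply: re_setI; first by apply: re_eta => //; solve_recursive.
  by apply: (re2_comp (re_nclasses heta)); solve_recursive.
by move=> w; split=> [[y [yz le]]|[y yz le]]; exists y.
Qed.

(** [good] is not assumed decidable, but its failure is enumerable. So [two_classes x] is enumerated
    in any case, and [init_classes eta (x + q)] is added once [x] is seen not to be good; it then
    contains [two_classes x], since 0 and [x] are at most [x + q]. *)
Lemma re_family : uniformly_re family.
Proof.
apply/re2E.
have famE w : (eta 0 (pi2 w) \/ eta (pi1 w) (pi2 w)) \/
    ((pi1 w <= q \/ exists v, v < pi1 w /\ eta v (pi1 w)) /\
      init_classes eta (pi1 w + q) (pi2 w)) <-> family (pi1 w) (pi2 w).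
  rewrite /family; set x := pi1 w; set z := pi2 w; case: ifPn => [gx|bx].
    split=> [[//|[[xq|[v [vx evx]]] _]]|]; last by left.
      by case/andP: gx; rewrite ltnNge xq.
    by case/andP: gx => _ /asboolP /(_ v vx).
  split=> [[[e|e]|[]//]|Bz].
  - by apply: init_classes_saturated (mem_init_classes _ _) e => //; rewrite leq0n.
  - by apply: init_classes_saturated (mem_init_classes _ _) e => //; exact: leq_addr.
  - right; split=> //; move: bx; rewrite negb_and -leqNgt => /orP[|/minimalPn[v vx evx]].
      by left.
    by right; exists v.
apply: (re_ext _ famE); apply: re_setU.
  by apply: re_setU; apply: re_eta => //; solve_recursive.
apply: re_setI.
  apply: re_setU; first by apply: re_decidable1; solve_recursive.
  apply: re_exists; apply: re_setI; last by apply: re_eta => //; solve_recursive.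
  by apply: re_decidable1; solve_recursive.
by apply: (re2_comp re_init_classes); solve_recursive.
Qed.

(** * An explanatory learner for the family *)

Lemma acceptable_decidable (V : nat -> nat -> bool) :
  decidable1 (fun w => V (pi1 w) (pi2 w)) ->
  exists2 f, recursive1 f & forall k, W (f k) = [set x | V k x].
Proof.
move=> rV; have [_ acc] := hW.
have [|f rf fP] := acc (fun k => [set x | V k x]); last by exists f.
by apply/re2E; exact: re_decidable1 rV.
Qed.

Lemma leq_code_prefix T n : n <= code_seq (prefix_of T n).
Proof. by rewrite -{1}(size_mkseq T n); exact: size_code_seq. Qed.

(* A datum in the class of [q] rules out the sets [two_classes x]; then the
   least number missing from the data determines the set.  Otherwise the least
   datum outside the class of 0 is the index [x]. *)
Lemma family_learnable : explanatorily_learnable W eta (range family).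
Proof.
(* [g0 y] is an index of the set of 0 and [y], and [g1 k] of the numbers below [k]; finite sets
   suffice because hypotheses are closed under [eta]. *)
have [|g0 rg0 g0P] := @acceptable_decidable (fun y x => (x == 0) || (x == y)).
  by solve_recursive.
have [|g1 rg1 g1P] := @acceptable_decidable (fun k x => x < k).
  by solve_recursive.
have [E rE [EP Emono]] := re2_bool heta.
(* The code [c] serves both as search bound and, in [outside], as stage of the approximation to
   [eta]; it is at least the length of the prefix. *)
pose missing c := find (fun y => ~~ occurs y c) (iota 0 c).
pose outside c := find (fun y => occurs y c && ~~ E c 0 y) (iota 0 c).
pose M s := let c := code_seq s in
  Some (if occurs q c then g1 (missing c) else g0 (outside c)).
exists M.
  exists (fun c => (if occurs q c then g1 (missing c) else g0 (outside c)).+1) => //.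
  apply: recursive1_S; apply: recursive1_if.
  - by apply: decidable1_occurs; solve_recursive.
  - apply: (recursive1_comp rg1); apply: recursive1_find; last exact: recursive1_id.
    by apply: decidable1_not; apply: decidable1_occurs; solve_recursive.
  - apply: (recursive1_comp rg0); apply: recursive1_find; last exact: recursive1_id.
    apply: decidable1_and; first by apply: decidable1_occurs; solve_recursive.
    apply: decidable1_not.
    have r : recursive1 (fun w => Cantor.to_nat (pi1 w, Cantor.to_nat (0, pi2 w))).
      by solve_recursive.
    have := recursive1_comp rE r; congr recursive1.
    by apply: funext => w; rewrite !(pi1K, pi2K).
move=> _ T [x _ <-] TL; rewrite /family in TL *; case: ifPn TL => [gx|bx] TL.
- exists (g0 x); split; last first.
    rewrite /hypothesis g0P; apply/seteqP; split=> [z [y /= /orP[]/eqP-> yz]|z []].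
    + by left.
    + by right.
    + by exists 0.
    + by exists x => //=; rewrite eqxx orbT.
  have [n0 n0P] := content_prefix T x.+1.
  (* A stage at which all numbers below [x] in the class of 0 are recognized. *)
  have [|y _ |s sP] := @exists_stage (fun y s => eta 0 y -> E s 0 y) x.
  - by move=> y s s' le imp /imp; exact: Emono.
  - have [/EP[s Es]|ne] := pselect (eta 0 y); last by exists 0.
    by exists s.
  exists (n0 + s + x.+1) => n le; rewrite /M.
  have cge := leq_code_prefix T n; have le0 : n0 <= n by lia.
  have memL y : occurs y (code_seq (prefix_of T n)) -> two_classes x y.
    by rewrite occursP -TL => /prefix_content.
  rewrite ifF; last by apply/negP => /memL; exact: good_notin_q.
  congr (Some (g0 _)); apply: find_iota_eq; first by lia.
    apply/andP; split.
      by rewrite occursP n0P //; rewrite -[content T]/(content T) TL; right.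
    by apply/negP => Ex; apply: (good_neq0 gx); apply/EP; exists (code_seq (prefix_of T n)).
  (* A datum below [x] cannot be equivalent to the minimal [x], so it belongs to the class of 0 and
     has been recognized. *)
  move=> y yx; apply/negP => /andP[/memL Ly /negP]; apply.
  apply: Emono (sP y yx _); first by lia.
  case: Ly => // xy; case/andP: gx => _ /asboolP /(_ y yx); case; exact: eta_sym.
- have [w [nw wmin wcl]] := closure_init_classes heta (x + q).
  exists (g1 w); split; last by rewrite /hypothesis g1P.
  (* The bound covers both the numbers below [w] and [q] itself. *)
  have [n0 n0P] := content_prefix T (w + q.+1).
  exists (n0 + w.+1) => n le; rewrite /M.
  have cge := leq_code_prefix T n; have le0 : n0 <= n by lia.
  have memT y : y < w + q.+1 -> init_classes eta (x + q) y ->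
      occurs y (code_seq (prefix_of T n)).
    by move=> lt By; rewrite occursP n0P // TL.
  rewrite memT; [|lia|exact: mem_init_classes (leq_addl _ _)].
  congr (Some (g1 _)); apply: find_iota_eq; first by lia.
    by rewrite occursP; apply/negP => /prefix_content; rewrite TL.
  by move=> y yw; rewrite negbK memT //; [lia|exact: wmin].
Qed.

(** * Failure of weakly confident learning *)

Hypothesis honly : forall A : set nat, re A /\ eta_infinite eta A <-> A = setT.

Section Divergence.
Variables (M : learner) (sigma : seq (option nat)).
Hypothesis recM : recursive_learner M.

(** The set called [Z] in the introduction. It ranges over all [x], good or not, which makes it a
    union of classes. *)
Definition mind_change : set nat := [set x | exists tau,
  (forall y, Some y \in tau -> two_classes x y) /\ M (sigma ++ tau) <> M sigma].

Lemma mind_change_saturated : saturated eta mind_change.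
Proof.
move=> x x' [tau [tauP neq]] xx'; exists tau; split=> // y /tauP[]; first by left.
by move=> xy; right; exact: eta_trans (eta_sym xx') xy.
Qed.

Hypothesis sigma0 : forall y, Some y \in sigma -> eta 0 y.

(** The search runs over codes [c] of whole sequences [sigma ++ tau]: such a [c] is recognized by
    stripping symbols until the code of [sigma] appears. Testing all symbols is harmless because
    [sigma] lies in the class of 0. *)
Lemma re_mind_change : re mind_change.
Proof.
have [f rf fP] := recM.
pose R x c := ((exists k, iter k code_belast c == code_seq sigma) /\
    f c != f (code_seq sigma)) /\
  forall k, k < c -> (code_last (iter k code_belast c) == 0) \/
    eta 0 (code_last (iter k code_belast c)).-1 \/ eta x (code_last (iter k code_belast c)).-1.
apply: (re_ext (re_exists (R := R) _)).
  have r_iter g h : recursive1 g -> recursive1 h ->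
      recursive1 (fun w => iter (g w) code_belast (h w)).
    by move=> rg rh; exact: recursive1_iter recursive1_code_belast rh rg.
  have r_sym g h : recursive1 g -> recursive1 h ->
      recursive1 (fun w => code_last (iter (g w) code_belast (h w))).
    by move=> rg rh; exact: recursive1_comp recursive1_code_last (r_iter _ _ rg rh).
  apply: re_setI; first apply: re_setI.
  - apply: re_exists; apply: re_decidable1; apply: decidable1_eq; last exact: recursive1_const.
    by apply: r_iter; solve_recursive.
  - apply: re_decidable1; apply: decidable1_not; apply: decidable1_eq; last exact: recursive1_const.
    exact: recursive1_comp rf recursive1_pi2.
  - apply: re_bounded_forall; first exact: recursive1_pi2.
    apply: re_setU; [apply: re_decidable1; apply: decidable1_eq|apply: re_setU; apply: re_eta => //].
    all: try apply: recursive1_P; try apply: r_sym; solve_recursive.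
move=> x; split=> [[c [[[k /eqP kc] neq] cP]]|[tau [tauP neq]]].
  have [s sc] := code_seq_surj c; rewrite -sc in kc neq cP.
  (* The last [k] symbols of [s], those stripped to reach [sigma], form [tau]. *)
  exists (drop (size s - k) s); move: kc; rewrite iter_code_belast => /code_seq_inj kc.
  split; last first.
    by rewrite -{1}kc cat_take_drop => eqM; move: neq; rewrite !fP eqM eqxx.
  move=> y /mem_drop; rewrite -mem_rev => ys.
  have idx : index (Some y) (rev s) < code_seq s.
    by apply: leq_trans (size_code_seq s); rewrite -size_rev index_mem.
  by have := cP _ idx; rewrite code_last_iter nth_index //= => -[].
exists (code_seq (sigma ++ tau)); split; first split.
- by exists (size tau); rewrite iter_code_belast_cat.
- by apply/eqP; rewrite !fP => /code_opt_inj.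
move=> k _; rewrite code_last_iter; case E : (nth _ _ _) => [y|]; last by left.
right; have : Some y \in sigma ++ tau.
  rewrite -mem_rev -E mem_nth // ltnNge; apply/negP => le.
  by rewrite nth_default in E.
by rewrite mem_cat => /orP[/sigma0|/tauP]; [left|].
Qed.

(** Without a mind change, [M] sticks to its output on [sigma] along a text for [two_classes x] that
    begins with [sigma]. That one output would have to name both sets. *)
Lemma good_no_mind_change x y :
  explanatorily_learns W eta M (range family) ->
  good x -> good y -> ~ mind_change x -> ~ mind_change y -> x = y.
Proof.
move=> learn gx gy nx ny.
have hypE z : good z -> ~ mind_change z ->
    exists2 e, M sigma = Some e & hypothesis W eta e = two_classes z.
  move=> gz nz; pose T := extend_text sigma (two_classes z).
  have TL : text_for (two_classes z) T.
    by apply: content_extend => u /sigma0; left.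
  have [|e [[n0 conv] he]] := learn (two_classes z) T _ TL.
    by exists z => //; rewrite /family gz.
  exists e => //; have [|tau Ttau tauP] := @prefix_extend sigma (two_classes z) (n0 + size sigma).
    exact: leq_addl.
  rewrite -(conv (n0 + size sigma) (leq_addr _ _)) Ttau.
  by apply: contrapT => neq; apply: nz; exists tau; split=> // /esym.
have [e Me he] := hypE x gx nx; have [e' Me' he'] := hypE y gy ny.
apply: two_classes_inj => //; rewrite -he -he'.
by move: Me'; rewrite Me => -[->].
Qed.

(** The classes outside [mind_change] have a least element at most [q] or belong to the single
    exception [x0], so finitely many classes inside would make [eta] have finitely many in all. *)
Lemma mind_change_infinite :
  explanatorily_learns W eta M (range family) -> eta_infinite eta mind_change.
Proof.
move=> learn; exists (eta_class eta @` mind_change); split.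
- by move=> _ [x _ <-]; exists x.
- move=> fin; case: heta => _ _; apply.
  have [x0 x0P] : exists x0, forall x, good x -> ~ mind_change x -> x = x0.
    have [[x0 [g0 n0]]|none] := pselect (exists x, good x /\ ~ mind_change x).
      by exists x0 => x gx nx; exact: good_no_mind_change.
    by exists 0 => x gx nx; case: none; exists x.
  apply: (@sub_finite_set _ _ (eta_class eta @` mind_change `|`
      (eta_class eta @` `I_q.+1 `|` [set eta_class eta x0]))); last first.
    rewrite !finite_setU; split=> //; split; last exact: finite_set1.
    by apply: finite_image; exact: finite_II.
  move=> _ [x _ <-]; have [u mu /(eta_class_eq heta) <-] := minimal_rep heta x.
  have [uq|qu] := leqP u q; first by right; left; exists u.
  have gu : good u by rewrite /good qu.
  have [Zu|nZu] := pselect (mind_change u); first by left; exists u.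
  by right; right; rewrite /= (x0P u).
- by apply: saturated_bigcup => //; exact: mind_change_saturated.
Qed.

End Divergence.

Lemma family_not_weakly_confident :
  ~ weakly_confidently_learnable W eta (range family).
Proof.
move=> [M recM [learn conf]].
have [u qu mu] := minimal_unbounded heta q.+1.
have gu : good u by rewrite /good qu.
have [|sigma sigma0 stab] := @stabilizing_sequence M (eta_class eta 0).
  (* Weak confidence covers texts over the class of 0, as this class is part of the member
     [family u]. *)
  move=> T T0; apply: (conf (family u)); first by exists u.
  by move=> z /T0; rewrite /family gu; left.
have reZ := re_mind_change recM sigma0.
have infZ := mind_change_infinite sigma0 learn.
have ZT := (honly _).1 (conj reZ infZ).
(* For [x = 0] the two classes coincide, so [tau] stays in the class of 0, where [sigma] is
   stabilizing. *)
have [tau [tau0]] : mind_change M sigma 0 by rewrite ZT.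
by apply; apply: stab => y /tau0[].
Qed.

End Family.

Theorem theorem15 (W : nat -> set nat) (hW : acceptable W)
    (eta : nat -> nat -> Prop) (heta : positive eta)
    (honly : forall A : set nat, re A /\ eta_infinite eta A <-> A = setT) :
  exists C : set (set nat),
    [/\ eta_family eta C,
        explanatorily_learnable W eta C
      & ~ weakly_confidently_learnable W eta C].
Proof.
(* A positive minimal [q] is not equivalent to the smaller number 0. *)
have [q q1 mq] := minimal_unbounded heta 1.
have eta0q : ~ eta 0 q by move/asboolP: mq; apply.
exists (range (family eta q)); split.
- split; last by exists (family eta q); split=> //; [exact: re_family|exact: family_inj].
  by move=> _ [x _ <-]; apply: saturated_closed => //; exact: family_saturated.
- exact: family_learnable.
- exact: family_not_weakly_confident.
Qed.
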